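(* For every positive integer $m$, the orbit Cayley graph $Cay(Z_2^{4m+2},S_0\cup S_3)$ is strongly regular with parameters $$\left(2^{4m+2},\;2^{4m+1}-(-1)^m2^{2m}-1,\;2^{4m}-(-1)^m2^{2m}-2,\;2^{4m}-(-1)^m2^{2m}\right).$$
   Context: $Z_2^n$ is the elementary abelian $2$-group of rank $n$, viewed as the vector space $F_2^n$; here $n=4m+2$. For $v\in Z_2^n$, $|v|$ is the number of coordinates equal to $1$, and $O_i=\{v\in Z_2^n : |v|=i\}$ for $0\le i\le n$. Set $S_0=\bigcup_{i\neq 0,\ i\equiv 0 \,(\mathrm{mod}\ 4)}O_i$ and, for $a\in\{1,2,3\}$, $S_a=\bigcup_{i\equiv a\,(\mathrm{mod}\ 4)}O_i$, with $0\le i\le n$. For a group $G$ and $S\subseteq G$ with $1\notin S$ and $S=S^{-1}$, the Cayley graph $Cay(G,S)$ has vertex set $G$, with $x,y$ adjacent iff $x^{-1}y\in S$; it is called an orbit Cayley graph over $Z_2^n$ if $G=Z_2^n$ and $S$ is a union of some of the $O_i$. A strongly regular graph with parameters $(N,r,\lambda,\mu)$ is a connected $r$-regular graph on $N$ vertices in which any two adjacent vertices have exactly $\lambda$ common neighbours and any two distinct non-adjacent vertices have exactly $\mu$ common neighbours. *)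

(* Defs.v *)
From HB Require Import structures.
From mathcomp Require Import all_boot all_order all_algebra all_fingroup.

Set Implicit Arguments.
Unset Strict Implicit.
Unset Printing Implicit Defensive.

Import GRing.Theory.

Record sgraph := SGraph {
  vertex :> finType;
  adj : rel vertex;
  adj_sym : symmetric adj;
  adj_irr : irreflexive adj
}.

Arguments adj {s}.

Definition neighbours (G : sgraph) (x : G) : {set G} := [set y | adj x y].

(* The parameters are integers, so that expressions such as (-1)^m and
   subtractions in them have their usual meaning. *)
Definition strongly_regular (G : sgraph) (N r lambda mu : int) : Prop :=
  [/\ #|G|%:Z%R = N,
      forall x y : G, connect adj x y,
      forall x : G, #|neighbours x|%:Z%R = r,
      forall x y : G, adj x y ->
        #|neighbours x :&: neighbours y|%:Z%R = lambda
    & forall x y : G, x != y -> ~~ adj x y ->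
        #|neighbours x :&: neighbours y|%:Z%R = mu].

Section Cayley.
Local Open Scope group_scope.
Variables (gT : finGroupType) (S : {set gT}).

Definition Cay_adj : rel gT := fun x y => x^-1 * y \in S.

Lemma Cay_adj_sym : S^-1 = S -> symmetric Cay_adj.
Proof.
by move=> SV x y; rewrite /Cay_adj -[in RHS]SV inE invMg invgK.
Qed.

Lemma Cay_adj_irr : 1 \notin S -> irreflexive Cay_adj.
Proof. by move=> S1 x; rewrite /Cay_adj mulVg; apply/negbTE. Qed.

Definition Cay (S1 : 1 \notin S) (SV : S^-1 = S) : sgraph :=
  SGraph (Cay_adj_sym SV) (Cay_adj_irr S1).

End Cayley.

(* The canonical (multiplicatively written) group structure on row vectors
   is the additive one. *)
Definition Z2 (n : nat) : finGroupType := 'rV['F_2]_n.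

Definition weight (n : nat) (v : Z2 n) : nat :=
  #|[set j : 'I_n | (v : 'rV['F_2]_n) ord0 j == 1%R]|.

Definition O_ (n i : nat) : {set Z2 n} := [set v | weight v == i].

(* The condition i != 0 is only relevant when a = 0. *)
Definition S_ (n a : nat) : {set Z2 n} :=
  \bigcup_(i < n.+1 | (i != 0 :> nat) && (i == a %[mod 4])) O_ n i.

Definition orbit_union (n : nat) (A : {set Z2 n}) : Prop :=
  exists I : {set 'I_n.+1}, A = \bigcup_(i in I) O_ n i.

Lemma Z2_invs (n : nat) (A : {set Z2 n}) : (A^-1 = A)%g.
Proof.
apply/setP=> v; rewrite inE; congr (_ \in A).
by apply/rowP=> j; rewrite mxE; case: (_ j) => [[|[|[]]]] // ?; apply/val_inj.
Qed.

Definition orbit_Cay (n : nat) (A : {set Z2 n}) (A_orbits : orbit_union A)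
    (A1 : 1%g \notin A) : sgraph :=
  Cay A1 (Z2_invs A).

Arguments orbit_Cay {n} A A_orbits A1.

Lemma orbit_union_S03 (n : nat) : orbit_union (S_ n 0 :|: S_ n 3).
Proof.
exists ([set i : 'I_n.+1 | (i != 0 :> nat) && (i == 0 %[mod 4])]
        :|: [set i : 'I_n.+1 | (i != 0 :> nat) && (i == 3 %[mod 4])]).
rewrite bigcup_setU /S_; congr (_ :|: _); apply: eq_bigl => i; by rewrite inE.
Qed.

Lemma id_notin_S03 (n : nat) : 1%g \notin S_ n 0 :|: S_ n 3.
Proof.
have w1 : weight (1%g : Z2 n) = 0.
  by apply/eqP; rewrite cards_eq0 -subset0; apply/subsetP=> j; rewrite !inE mxE.
by rewrite inE negb_or; apply/andP; split; apply/negP=> /bigcupP[i /andP[/negP i0 _]];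
   rewrite inE w1 eq_sym => /i0.
Qed.

(* Main.v *)
Require Import Defs.
From mathcomp Require Import all_boot all_order all_algebra all_fingroup.
From mathcomp Require Import zify ring.

Set Implicit Arguments.
Unset Strict Implicit.
Unset Printing Implicit Defensive.

Import Order.TTheory GRing.Theory Num.Theory.
Local Open Scope ring_scope.

(** The set [S_0 :|: S_3] with the identity adjoined is the zero set of a
    quadratic form over F_2: weights 0 and 3 mod 4 are those
    for which w(w+1)/2 is even, and the parity of w(w+1)/2 at v is
    the quadratic form Q(v) = sum_(i <= j) v_i v_j ([quad_form]). Everything
    follows from two facts on the sign (-1)^Q.

    First, it is bent when n is even: for z nonzero, the sum over v of
    (-1)^(Q(v) + Q(z + v)) vanishes ([quad_form_autocorrelation]). Indeed
    Q(v + e_j) - Q(v) depends only on the parity of |v| and on v_j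
    ([quad_form_flip]), so the translation by a suitable e_j changes the sign
    of every term.

    Second, its sum over the cube depends on n through a two-step recursion:
    if a_n(k) denotes the sum of the signs with the weights shifted by k, then
    a_(n+1)(k) = a_n(k) + a_n(k+1) by Pascal's rule, while the sign is
    antiperiodic of period 2 in the weight; hence a_(n+2)(k) = 2 a_n(k+1) and
    a_(n+4) = -4 a_n ([binomial_sum_quad_sign]).

    Counting the zeros of Q, and the pairs of zeros differing by a fixed z, by
    means of the indicator (1 + (-1)^Q) / 2 expresses the numbers of neighbours
    and of common neighbours through these two sums. This last step holds for
    bent functions on any finite group ([strongly_regular_bent]). *)

(** * Cayley graphs of zero sets of bent functions *)

Section Bent.
Variables (gT : finGroupType) (S : {set gT}) (f : gT -> bool).
Variables k mu : int.
Hypotheses (S1 : 1%g \notin S) (SV : (S^-1)%g = S).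
Hypothesis SE : forall v, (v \in S) = (v != 1%g) && ~~ f v.
Hypothesis f1 : ~~ f 1%g.
Hypothesis autocorrelation : forall z : gT, z != 1%g ->
  \sum_u (-1) ^+ f u * (-1) ^+ f (z * u)%g = 0 :> int.
Hypothesis sum_sign : \sum_u (-1) ^+ f u = k * 2 - #|gT|%:Z.

Lemma sum_const1 : \sum_(u : gT) 1 = #|gT|%:Z.
Proof. by rewrite sumr_const natz. Qed.

(** The sum of the signs is the excess of the zeros of [f] over its nonzeros:
    twice the indicator of the zeros is 1 + (-1)^f. *)
Lemma card_zeros : #|[set u | ~~ f u]|%:Z = k.
Proof.
suff: #|[set u | ~~ f u]|%:Z * 2 = k * 2 by move=> h; lia.
have ->: k * 2 = \sum_(u : gT) 1 + \sum_u (-1) ^+ f u.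
  by rewrite sum_sign sum_const1; ring.
rewrite -big_split -natz -sum1_card natr_sum mulr_suml big_mkcond /=.
by apply: eq_bigr => u _; rewrite inE; case: (f u).
Qed.

(** Four times the indicator of the common zeros is the product of
    1 + (-1)^f(u) and 1 + (-1)^f(zu); bentness kills the term of degree 2. *)
Lemma card_common_zeros (z : gT) : z != 1%g ->
  #|[set u | ~~ f u & ~~ f (z * u)%g]|%:Z * 4 = k * 4 - #|gT|%:Z.
Proof.
move=> /autocorrelation z0.
have shift : \sum_u (-1) ^+ f (z * u)%g = k * 2 - #|gT|%:Z.
  by rewrite -sum_sign [RHS](reindex_inj (mulgI z)).
transitivity (\sum_(u : gT) 1 + \sum_u (-1) ^+ f u + \sum_u (-1) ^+ f (z * u)%g
   + \sum_u (-1) ^+ f u * (-1) ^+ f (z * u)%g :> int); last first.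
  by rewrite z0 shift sum_sign sum_const1; ring.
rewrite -!big_split -natz -sum1_card natr_sum mulr_suml big_mkcond /=.
by apply: eq_bigr => u _; rewrite inE; case: (f u); case: (f _).
Qed.

(** Translation by [x^-1] turns the common neighbours of [x] and [y] into the
    common zeros u of f(u) and f(zu), where z = y^-1 x, deprived of the
    points u = 1 and u = z^-1. These two points are common zeros exactly
    when f(z) = 0, that is when x and y are adjacent, which explains the
    difference of 2 between the last two parameters. Connectedness follows
    from [0 < mu]: distinct nonadjacent vertices have a common neighbour. *)
Lemma strongly_regular_bent : mu * 4 = k * 4 - #|gT|%:Z -> 0 < mu ->
  strongly_regular (Cay S1 SV) #|gT|%:Z (k - 1) (mu - 2) mu.
Proof.
move=> muE mu_gt0.
have nbr (x : gT) : #|neighbours (G := Cay S1 SV) x| = #|S|.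
  rewrite -(card_preimset _ (mulgI x^-1%g)).
  by apply: eq_card => y; rewrite !inE.
have cardS : #|S|%:Z = k - 1.
  have := card_zeros; rewrite (cardsD1 1%g) inE f1.
  have -> : [set u | ~~ f u] :\ 1%g = S by apply/setP=> u; rewrite !inE SE.
  by move=> <-; rewrite PoszD addrC addKr.
have common (x y : gT) :
    #|neighbours (G := Cay S1 SV) x :&: neighbours (G := Cay S1 SV) y|
    = #|[set u in S | (y^-1 * x * u)%g \in S]|.
  rewrite -[in RHS](card_preimset _ (mulgI x^-1%g)).
  by apply: eq_card => v; rewrite !inE /= /Cay_adj mulgA mulgK.
have commonE (z : gT) : z != 1%g ->
    #|[set u in S | (z * u)%g \in S]|%:Z = mu - (z \in S)%:Z * 2.
  move=> z1.
  have := card_common_zeros z1; rewrite -muE.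
  rewrite (cardsD1 1%g) (cardsD1 z^-1%g).
  have -> : [set u | ~~ f u & ~~ f (z * u)%g] :\ 1%g :\ z^-1%g
      = [set u in S | (z * u)%g \in S].
    apply/setP=> u; rewrite !inE !SE.
    by rewrite -eq_invg_mul (eq_sym z^-1%g); do 2 case: eqP => // _; rewrite ?andbF.
  have fz : ~~ f z = (z \in S) by rewrite SE z1.
  have fzV : ~~ f z^-1%g = (z \in S) by rewrite -[in RHS]SV inE SE invg_eq1 z1.
  rewrite !inE mulg1 mulgV f1 invg_eq1 z1 fz fzV /=.
  by move: #|[set u in S | _]|; case: (z \in S) => c /=; lia.
have nadj (x y : gT) : x != y -> (y^-1 * x)%g != 1%g.
  by rewrite -eq_mulVg1 eq_sym.
have adjE (x y : gT) : @adj (Cay S1 SV) x y = ((y^-1 * x)%g \in S).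
  by rewrite adj_sym.
have mu_nonadj (x y : gT) : x != y -> ~~ @adj (Cay S1 SV) x y ->
    #|neighbours (G := Cay S1 SV) x :&: neighbours (G := Cay S1 SV) y|%:Z = mu.
  move=> xy; rewrite adjE => /negbTE nS.
  by rewrite common commonE ?nadj // nS mul0r subr0.
split=> //.
- move=> x y; have [->|xy] := eqVneq x y; first exact: connect0.
  have [|nxy] := boolP (adj x y); first exact: connect1.
  have /card_gt0P[u] : (0 < #|neighbours x :&: neighbours y|)%N.
    by have := mu_nonadj x y xy nxy; lia.
  rewrite !inE => /andP[xu yu].
  by apply: (connect_trans (connect1 xu)); rewrite connect1 // adj_sym.
- by move=> x; rewrite nbr cardS.
- move=> x y xy.
  have nxy : x != y by apply: contraTneq xy => ->; rewrite adj_irr.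
  by rewrite common commonE ?nadj // -adjE xy.
Qed.

End Bent.

(** * The quadratic form *)

(** Since 'C(w.+1, 2) = w(w+1)/2, this is the recursion in w for the value of
    the quadratic form on vectors of weight w. *)
Lemma odd_bin2S w : odd 'C(w.+2, 2) = odd 'C(w.+1, 2) (+) ~~ odd w.
Proof. by rewrite binS bin1 oddD. Qed.

Lemma F2E (x : 'F_2) : x = (x == 1)%:R.
Proof. by case: x => [[|[|[]]]] // ?; apply/val_inj. Qed.

(** The weight of a uniform vector is binomially distributed, so these are the
    sums over the cube of functions of the weight. *)
Definition binomial_sum (g : nat -> int) n := \sum_(i < n.+1) g i *+ 'C(n, i).

Section Weight.
Variable n : nat.
Implicit Types u v z : 'rV['F_2]_n.

Let supp v := [set j | v ord0 j == 1].

Lemma sum_weight (g : nat -> int) :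
  \sum_(v : Z2 n) g (weight v) = binomial_sum g n.
Proof.
have suppK : cancel supp (fun A => \row_j (j \in A)%:R).
  by move=> v; apply/rowP=> j; rewrite mxE inE -F2E.
have rowK : cancel (fun A : {set 'I_n} => \row_j (j \in A)%:R) supp.
  by move=> A; apply/setP=> j; rewrite inE mxE; case: (j \in A).
rewrite (reindex (fun A : {set 'I_n} => \row_j (j \in A)%:R : Z2 n)) /=; last first.
  by exists supp => ? _; [apply: rowK | apply: suppK].
rewrite (partition_big (fun A : {set 'I_n} => inord #|A| : 'I_n.+1) xpredT) //=.
apply: eq_bigr => i _.
have cardE (A : {set 'I_n}) : (inord #|A| == i :> 'I_n.+1) = (#|A| == i).
  by rewrite -val_eqE /= inordK // ltnS -[n in (_ <= n)%N]card_ord max_card.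
rewrite (eq_bigr (fun=> g i)) => [|A]; last first.
  rewrite cardE => /eqP <-; congr (g _).
  by have := rowK A => /(congr1 (fun B : {set _} => #|B|)).
rewrite sumr_const; congr (_ *+ _).
have -> : 'C(n, i) = 'C(#|'I_n|, i) by rewrite card_ord.
rewrite -card_draws.
by apply: eq_card => A; rewrite inE unfold_in -cardE.
Qed.

(** In F_2 the weight is the sum of the coordinates, a linear form. *)
Lemma odd_weightD u v :
  odd (weight (u + v : Z2 n)) = odd (weight (u : Z2 n)) (+) odd (weight (v : Z2 n)).
Proof.
have wE w : (weight (w : Z2 n))%:R = \sum_j w ord0 j :> 'F_2.
  rewrite /weight -sum1_card natr_sum big_mkcond /=.
  by apply: eq_bigr => j _; rewrite inE [RHS]F2E; case: eqP.
have : (weight (u + v : Z2 n))%:R = (weight (u : Z2 n) + weight (v : Z2 n))%:R :> 'F_2.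
  by rewrite natrD !wE -big_split; apply: eq_bigr => j _; rewrite mxE.
move=> /(congr1 val); rewrite /= !val_Fp_nat // !modn2 -oddD.
by case: odd; case: odd.
Qed.

(** The form sum_(i <= j) v_i v_j: a vector of weight w has w diagonal terms
    and w(w-1)/2 off-diagonal ones equal to 1. *)
Definition quad_form v : bool := odd 'C((weight (v : Z2 n)).+1, 2).

Lemma quad_form_flip v (j : 'I_n) :
  quad_form (v + delta_mx ord0 j)
  = quad_form v (+) ~~ (odd (weight (v : Z2 n)) (+) (v ord0 j == 1)).
Proof.
have wE u : weight (u : Z2 n) = ((u ord0 j == 1%R) + #|supp u :\ j|)%N.
  by rewrite /weight (cardsD1 j) inE.
rewrite /quad_form !wE.
have -> : supp (v + delta_mx ord0 j) :\ j = supp v :\ j.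
  apply/setP=> i; rewrite !inE !mxE; case: eqVneq => //= _.
  by rewrite addr0.
rewrite !mxE !eqxx (F2E (v ord0 j)).
case: (v ord0 j == 1%R); rewrite !(add0n, add1n) odd_bin2S /=.
  by do 2 case: odd.
by do 2 case: odd.
Qed.

(** By [quad_form_flip], translating v by e_j multiplies the term of v by
    (-1)^(|z| + z_j), whatever v is. If |z| is even, any j in the support of
    the nonzero z makes this -1; if |z| is odd, any j outside the support does,
    and there is one because n is even. *)
Lemma quad_form_autocorrelation z : ~~ odd n -> z != 0 ->
  \sum_(v : Z2 n) (-1) ^+ quad_form v * (-1) ^+ quad_form (z + v) = 0 :> int.
Proof.
move=> n_even z_neq0.
have [j zj] : exists j, odd (weight (z : Z2 n)) (+) (z ord0 j == 1).
  have [z_odd|z_even] := boolP (odd (weight (z : Z2 n))).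
    have : supp z != setT.
      apply: contraNneq n_even => zT.
      by move: z_odd; rewrite /weight -/(supp z) zT cardsT card_ord.
    rewrite -subTset => /subsetPn[j _]; rewrite inE => zj.
    by exists j; rewrite (negbTE zj).
  have /set0Pn[j] : supp z != set0.
    apply: contraNneq z_neq0 => z0; apply/eqP/rowP=> j.
    by move/setP/(_ j): z0; rewrite !inE => zj; rewrite mxE [LHS]F2E zj.
  by rewrite inE => zj; exists j; rewrite zj.
set T := \sum_v _; suff : T = - T by lia.
rewrite {1}/T (reindex_inj (addIr (delta_mx ord0 j : 'rV['F_2]_n))) -sumrN.
apply: eq_bigr => v _; rewrite addrA !quad_form_flip odd_weightD.
move: zj; rewrite mxE (F2E (z ord0 j)) (F2E (v ord0 j)).
by case: (z ord0 j == 1%R); case: (v ord0 j == 1%R); do 2 case: odd;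
   do 2 case: (quad_form _).
Qed.
End Weight.

(** * The sum of the signs *)

Definition quad_sign (w : nat) : int := (-1) ^+ 'C(w.+1, 2).

Lemma quad_sign_shift2 i : quad_sign i.+2 = - quad_sign i.
Proof.
rewrite /quad_sign -signr_odd -[in RHS]signr_odd !odd_bin2S /=.
by do 2 case: odd.
Qed.

Lemma binomial_sumS g n :
  binomial_sum g n.+1 = binomial_sum g n + binomial_sum (g \o succn) n.
Proof.
rewrite /binomial_sum big_ord_recl /= bin0.
under eq_bigr do rewrite binS mulrnDr.
rewrite big_split /= addrA; congr (_ + _).
rewrite big_ord_recr /= bin_small // mulr0n addr0 [RHS]big_ord_recl /=.
by rewrite bin0.
Qed.

(** Applying Pascal's rule twice gives the values of g at shifts 0, 1, 1, 2;
    shifts 0 and 2 cancel by antiperiodicity. So two more dimensions amount to a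
    factor 2 and a shift by 1, and four more to a factor -4. *)
Lemma binomial_sum_quad_sign m :
  binomial_sum quad_sign (4 * m + 2) = - ((-1) ^+ m * 2 ^+ (2 * m).+1).
Proof.
have tr_ext g h n : g =1 h -> binomial_sum g n = binomial_sum h n.
  by move=> gh; apply: eq_bigr => i _; rewrite gh.
have trN g n : binomial_sum (fun i => - g i) n = - binomial_sum g n.
  by rewrite -sumrN; apply: eq_bigr => i _; rewrite mulNrn.
have step2 g n : g \o succn \o succn =1 (fun i => - g i) ->
    binomial_sum g n.+2 = binomial_sum (g \o succn) n * 2.
  by move=> gN; rewrite !binomial_sumS (tr_ext _ _ _ gN) trN; ring.
have sN : quad_sign \o succn \o succn =1 (fun i => - quad_sign i).
  by move=> i; exact: quad_sign_shift2.
have sN' : quad_sign \o succn \o succn \o succn =1 (fun i => - (quad_sign \o succn) i).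
  by move=> i; exact: quad_sign_shift2.
elim: m => [|m IHm].
  by rewrite /binomial_sum !big_ord_recl big_ord0.
have -> : (4 * m.+1 + 2 = (4 * m + 2).+4)%N by lia.
rewrite !step2 // (tr_ext _ _ _ sN) trN IHm.
have -> : ((2 * m.+1).+1 = (2 * m).+3)%N by lia.
by rewrite !exprS; ring.
Qed.

(** * The connection set *)

Lemma weight_eq0 n (v : Z2 n) : (weight v == 0)%N = (v == 1%g).
Proof.
rewrite cards_eq0; apply/eqP/eqP=> [/setP v0|->].
  by apply/rowP=> j; have := v0 j; rewrite !inE => vj; rewrite mxE [LHS]F2E vj.
by apply/setP=> j; rewrite !inE mxE.
Qed.

Lemma in_S03 n (v : Z2 n) :
  (v \in S_ n 0 :|: S_ n 3) = (v != 1%g) && ~~ quad_form v.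
Proof.
have wn : (weight v < n.+1)%N by rewrite ltnS -[n in (_ <= n)%N]card_ord max_card.
have inS a : (v \in S_ n a) = (weight v != 0)%N && (weight v == a %[mod 4]).
  apply/bigcupP/idP => [[i iP]|wP]; first by rewrite inE => /eqP->.
  by exists (Ordinal wn); rewrite ?inE.
rewrite inE !inS -weight_eq0 -andb_orr; congr (_ && _); rewrite /quad_form.
move: (weight v) => w.
rewrite (divn_eq w 4); move: (w %/ 4)%N (w %% 4)%N (ltn_mod w 4) => q r rlt.
(* the parity of w(w+1)/2 has period 4 in w *)
have -> : odd 'C((q * 4 + r).+1, 2) = odd 'C(r.+1, 2).
  elim: q => // q <-; rewrite mulSn -addnA.
  by rewrite !add4n !odd_bin2S /=; do 2 case: odd.
rewrite !modnMDl.
by case: r rlt => [|[|[|[|]]]].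
Qed.

Theorem theorem8 (m : nat) (m_gt0 : (0 < m)%N) :
  strongly_regular
    (orbit_Cay (S_ (4 * m + 2) 0 :|: S_ (4 * m + 2) 3)
       (orbit_union_S03 (4 * m + 2)) (id_notin_S03 (4 * m + 2)))
    (2 ^+ (4 * m + 2))%R
    (2 ^+ (4 * m + 1) - (-1) ^+ m * 2 ^+ (2 * m) - 1)%R
    (2 ^+ (4 * m) - (-1) ^+ m * 2 ^+ (2 * m) - 2)%R
    (2 ^+ (4 * m) - (-1) ^+ m * 2 ^+ (2 * m))%R.
Proof.
set n := (4 * m + 2)%N.
have cardZ : #|Z2 n|%:Z = 2 ^+ n by rewrite card_mx card_Fp // mul1n -natz natrX.
have signE (v : Z2 n) : (-1) ^+ quad_form v = quad_sign (weight v).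
  by rewrite /quad_form signr_odd.
rewrite -cardZ /orbit_Cay; apply: (@strongly_regular_bent _ _ (@quad_form n)).
- exact: in_S03.
- by rewrite /quad_form (eqP (_ : weight (1%g : Z2 n) == 0)%N) // weight_eq0.
- by move=> z z0; apply: quad_form_autocorrelation; rewrite // /n; lia.
- rewrite cardZ; under eq_bigr do rewrite signE.
  rewrite sum_weight binomial_sum_quad_sign /n !(exprD _ (4 * m)%N) exprS; ring.
- by rewrite cardZ /n !(exprD _ (4 * m)%N); ring.
(* with x = 2 ^ (2 m) > 1, the last parameter is x ^ 2 - x or x ^ 2 + x *)
- have -> : (4 * m = 2 * m + 2 * m)%N by lia.
  have : 1 < 2 ^+ (2 * m) :> int by rewrite exprn_egt1 //; lia.
  rewrite (exprD _ (2 * m)%N (2 * m)%N) -[(-1) ^+ m]signr_odd.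
  move: (2 ^+ (2 * m)) => x x_gt1.
  by case: odd; rewrite /= ?expr0 ?expr1; nia.
Qed.
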